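(* There exist a universal constant $c\ge1$, a constant $p\in(0,1)$, and a (possibly randomized) order-oblivious secretary algorithm with sampling fraction $p$ for the combinatorial allocation problem which is $c$-competitive for XOS (in particular, submodular) buyers. That is, for all $n,m\ge1$, all XOS valuations $v_1,\dots,v_n$ on the item set $[m]$, and every adversarial choice of the arrival order of the non-sampled buyers, the expected welfare $\mathbb{E}[\sum_i v_i(\mathsf{ALG}_i)]$ of the algorithm's allocation is at least $\frac1c\max_{(A_1,\dots,A_n)}\sum_{i=1}^n v_i(A_i)$, where the maximum is over all tuples of pairwise disjoint sets $A_1,\dots,A_n\subseteq[m]$.
   Context: Valuations: a valuation is a function $v:2^{[m]}\to\mathbb{R}_{\ge0}$ that is normalized ($v(\emptyset)=0$) and monotone ($v(S)\le v(T)$ for $S\subseteq T$). $v$ is XOS if there is a finite collection of additive functions $a_\ell(B)=\sum_{j\in B}a_\ell(j)$ with $a_\ell(j)\ge0$ such that $v(B)=\max_\ell a_\ell(B)$ for all $B\subseteq[m]$. (Monotone, normalized) submodular valuations are XOS. Order-oblivious secretary model: an adversary chooses $n$ valuations $v_1,\dots,v_n$, one per buyer. The algorithm knows $n$ and $m$. A uniformly random subset of the buyers containing a constant fraction of them (of size $\lfloor pn\rfloor$, with $p$ a constant fixed by the algorithm) is drawn, and their valuations are revealed to the algorithm as a sample; nothing is allocated to sampled buyers. The remaining buyers then arrive one by one in adversarial order (the order may depend on the valuations and on the realized sample set). When a buyer arrives, its valuation is revealed and the algorithm must immediately and irrevocably allocate to it a (possibly empty) subset of the still unallocated items, based only on the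 sample, the arrivals so far and its internal randomness. $\mathsf{ALG}_i$ denotes the set allocated to buyer $i$ (empty for sampled buyers). The expectation is over the random sample set and the algorithm's randomness. *)

(* Defs.v *)
From HB Require Import structures.
From mathcomp Require Import all_boot all_order all_algebra.
From mathcomp Require Import all_classical all_reals all_analysis.

Set Implicit Arguments.
Unset Strict Implicit.
Unset Printing Implicit Defensive.

Import Order.TTheory GRing.Theory Num.Theory.

Local Open Scope ring_scope.

Definition setfun (R : realType) (m : nat) : Type := {ffun {set 'I_m} -> R}.

Definition is_valuation (R : realType) (m : nat) (v : setfun R m) : Prop :=
  [/\ forall S, 0 <= v S,
      v finset.set0 = 0
    & forall S T : {set 'I_m}, S \subset T -> v S <= v T].

(* The neutral element 0 does not affect the maximum: the family is nonempty
   (it has k.+1 members) and all its values are nonnegative. *)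
Definition XOS (R : realType) (m : nat) (v : setfun R m) : Prop :=
  is_valuation v /\
  exists (k : nat) (a : 'I_k.+1 -> 'I_m -> R),
    (forall l j, 0 <= a l j) /\
    (forall B : {set 'I_m},
       v B = \big[Num.max/0]_(l < k.+1) \sum_(j in B) a l j).

Definition submodular (R : realType) (m : nat) (v : setfun R m) : Prop :=
  is_valuation v /\
  forall S T : {set 'I_m}, v (S :|: T) + v (S :&: T) <= v S + v T.

Definition buyer (R : realType) (n m : nat) : Type := ('I_n * setfun R m)%type.

(* [decide w sample past b avail] is the set given to the arriving buyer [b]
   when the internal randomness is [w], the revealed sample is [sample], the
   earlier arrivals are [past] (oldest first) and [avail] is the set of
   unallocated items.  The algorithm's earlier allocations need not be passed:
   they are determined by [w], [sample] and [past]. *)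
Record secretary_algorithm (R : realType) (n m : nat) := SecretaryAlgorithm {
  seed_display : measure_display;
  seed : measurableType seed_display;
  seed_prob : probability seed R;
  decide : seed -> seq (buyer R n m) -> seq (buyer R n m) -> buyer R n m ->
           {set 'I_m} -> {set 'I_m};
  decide_avail : forall w sample past b avail,
    decide w sample past b avail \subset avail;
  decide_measurable : forall sample past b avail (A : {set 'I_m}),
    measurable [set w | decide w sample past b avail = A]%classic
}.

Fixpoint serve (R : realType) (n m : nat) (alg : secretary_algorithm R n m)
    (w : seed alg) (sample past : seq (buyer R n m)) (avail : {set 'I_m})
    (arrivals : seq (buyer R n m)) : 'I_n -> {set 'I_m} :=
  if arrivals is b :: arrivals' then
    let A := decide w sample past b avail in
    let rest := serve w sample (rcons past b) (avail :\: A) arrivals' in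
    fun i => if i == b.1 then A else rest i
  else fun=> finset.set0.

Definition reveal (R : realType) (n m : nat) (v : 'I_n -> setfun R m)
    (s : seq 'I_n) : seq (buyer R n m) := [seq (i, v i) | i <- s].

Definition ALG (R : realType) (n m : nat) (alg : secretary_algorithm R n m)
    (v : 'I_n -> setfun R m) (S : {set 'I_n}) (order : seq 'I_n)
    (w : seed alg) : 'I_n -> {set 'I_m} :=
  serve w (reveal v (enum S)) [::] [set: 'I_m] (reveal v order).

Definition welfare (R : realType) (n m : nat) (v : 'I_n -> setfun R m)
    (A : 'I_n -> {set 'I_m}) : R := \sum_(i < n) v i (A i).

Definition pairwise_disjoint (n m : nat) (A : 'I_n -> {set 'I_m}) : bool :=
  [forall i, forall j, (i != j) ==> [disjoint A i & A j]].

(* The default value 0 is the welfare of the empty allocation whenever the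
   [v i] are normalized, so for valuations this is the true maximum. *)
Definition opt (R : realType) (n m : nat) (v : 'I_n -> setfun R m) : R :=
  \big[Num.max/0]_(A : {ffun 'I_n -> {set 'I_m}} | pairwise_disjoint A)
    welfare v A.

Definition sample_size (R : realType) (p : R) (n : nat) : nat :=
  Num.truncn (p * n%:R).

(* The order may depend on the sample set; it may also depend on the
   valuations because it is quantified after them.  It cannot depend on the
   algorithm's internal randomness. *)
Definition arrival_order (n k : nat) (order : {set 'I_n} -> seq 'I_n) : Prop :=
  forall S : {set 'I_n}, #|S| = k -> perm_eq (order S) (enum (~: S)).

(* The sample is uniform among the sets of size [sample_size p n] and
   independent of the internal randomness. *)
Definition expected_welfare (R : realType) (n m : nat) (p : R)
    (alg : secretary_algorithm R n m) (v : 'I_n -> setfun R m)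
    (order : {set 'I_n} -> seq 'I_n) : \bar R :=
  (('C(n, sample_size p n)%:R^-1)%:E *
   \sum_(S : {set 'I_n} | #|S| == sample_size p n)
     expectation (seed_prob alg)
       (fun w => welfare v (ALG v S (order S) w)))%E.

Definition competitive (R : realType) (c p : R)
    (alg : forall n m, secretary_algorithm R n m)
    (class : forall m, setfun R m -> Prop) : Prop :=
  forall n m : nat, (0 < n)%N -> (0 < m)%N ->
  forall v : 'I_n -> setfun R m, (forall i, class m (v i)) ->
  forall order : {set 'I_n} -> seq 'I_n,
    arrival_order (sample_size p n) order ->
    ((c^-1 * opt v)%:E <= expected_welfare p (alg n m) v order)%E.

(* Main.v *)
(* Post the following prices to a sequence of buyers: with current item prices
   w, a buyer with valuation v bids an additive function a <= v supporting a
   bundle demanded at prices w, and w becomes the pointwise maximum of w and a.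
   This greedy process collects total price at least half the optimum of the
   buyers it has seen, in any order.

   The sample, in random order, provides a history h_t (t < s, with s about n/3)
   and a second block e_t; the unsampled buyers, in random order, provide d_t.
   Let d_t and e_t bid at the prices generated by h_0, ..., h_{t-1} only.  Given
   the history before t, h_t and d_t are exchangeable, so (decoupling of tangent
   sequences) for each item the expected largest bid among the d_t is at least
   half the expected largest bid among the h_t, which is the final price.  The
   bids of the d_t do not depend on the arrival order and are additive, so each
   item is a separate single-item problem: give it to a d_t outbidding every
   e_t.  By exchangeability of d_t and e_t, with probability at least 1/4 the
   largest bid is among the d_t and the next largest among the e_t, and then the
   item goes to the largest bidder whatever the arrival order.  The constant is
   80 = 2 * 2 * 4 * 5, the factor 5 coming from s >= n/5 for n >= 3. *)

Require Import Defs.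
From HB Require Import structures.
From mathcomp Require Import all_boot all_order all_algebra all_fingroup.
From mathcomp Require Import all_classical all_reals all_analysis.
From mathcomp Require Import zify ring lra.

Set Implicit Arguments.
Unset Strict Implicit.
Unset Printing Implicit Defensive.

Import Order.TTheory GRing.Theory Num.Theory.

Local Open Scope ring_scope.

(** * Supporting prices and greedy bidding *)

Section Supports.
Context {R : realType} {m : nat}.
Implicit Types (v : setfun R m) (a w : {ffun 'I_m -> R}) (B C : {set 'I_m}).

Definition additive_below v a :=
  (forall j, 0 <= a j) /\ (forall B, \sum_(j in B) a j <= v B).

(** Besides being valuations, both classes of the theorem enter the argument only through this
    bundle-by-bundle form of XOS. *)
Definition supported v :=
  forall B, exists2 a, additive_below v a & v B = \sum_(j in B) a j.

Lemma XOS_supported v : XOS v -> supported v.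
Proof.
move=> [[v0 _ _] [k [a [a0 va]]]] B.
have := va B; rewrite (@bigmax_eq_arg _ _ _ _ ord0) // => [|l _]; last first.
  exact: sumr_ge0.
set l := Order.arg_max _ _ _ => vB.
exists [ffun j => a l j].
  split=> [j|C]; first by rewrite ffunE.
  rewrite (eq_bigr (a l)) => [|j _]; last by rewrite ffunE.
  rewrite va; exact: (le_bigmax_cond _ (fun l => \sum_(j in C) a l j)).
by rewrite vB; apply: eq_bigr => j _; rewrite ffunE.
Qed.

(* Greedy marginals along any ordering of [B]. *)
Lemma submodular_supported v : submodular v -> supported v.
Proof.
move=> [[v0 vnil vmon] vsub] B.
suff [a av] : exists2 a, additive_below v a &
    v B = \sum_(j in B) a j /\ (forall j, j \notin B -> a j = 0).
  by case=> vB _; exists a.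
have [N] := ubnP #|B|; elim: N B => // N IH B; rewrite ltnS => BN.
have [->|[j jB]] := set_0Vmem B.
  exists [ffun=> 0]; first split=> [j|C]; first by rewrite ffunE.
    by rewrite big1 => // j _; rewrite ffunE.
  by split=> [|j _]; rewrite ?finset.big_set0 ?ffunE.
have /IH : (#|B :\ j| < N)%N by move: BN; rewrite (cardsD1 j B) jB.
move=> [a [a0 ale] [vE aout]].
exists [ffun i => if i == j then v B - v (B :\ j) else a i].
  split=> [i|C].
    by rewrite ffunE; case: eqP => // _; rewrite subr_ge0 vmon ?finset.subD1set.
  have sumE D : j \notin D ->
      \sum_(i in D) [ffun i => if i == j then v B - v (B :\ j) else a i] i =
      \sum_(i in D) a i.
    move=> jD; apply: eq_bigr => i iD; rewrite ffunE.
    by case: eqP iD jD => // ->->.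
  have [jC|jC] := boolP (j \in C); last by rewrite sumE.
  rewrite (finset.big_setD1 j) //= ffunE eqxx sumE ?finset.setD11 //.
  set D := (C :&: B) :\ j.
  have -> : \sum_(i in C :\ j) a i = \sum_(i in D) a i.
    rewrite [LHS](finset.big_setID B) /= [X in _ + X]big1 ?addr0.
      by apply: eq_bigl => i; rewrite !inE; do !case: (_ \in _); case: (_ == _).
    move=> i; rewrite !inE => /andP[iB /andP[ij _]].
    by rewrite aout // !inE (negbTE iB) andbF.
  have := vsub (j |: D) (B :\ j).
  have -> : (j |: D) :|: (B :\ j) = B.
    apply/finset.setP => i; rewrite !inE.
    by case: eqP => [->|_] //=; case: (i \in B); rewrite ?andbF ?orbT.
  have -> : (j |: D) :&: (B :\ j) = D.
    by apply/finset.setP => i; rewrite !inE; case: (i == j); case: (i \in B); rewrite ?andbF ?andbT ?orbF.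
  have : v (j |: D) <= v C.
    by apply: vmon; apply/fintype.subsetP => i; rewrite !inE => /orP[/eqP->|/and3P[]].
  have := ale D; lra.
split; last first.
  move=> i iB; rewrite ffunE; case: eqP => [ij|_]; first by rewrite ij jB in iB.
  by apply: aout; rewrite !inE (negbTE iB) andbF.
rewrite (finset.big_setD1 j) //= ffunE eqxx.
rewrite (eq_bigr a) => [|i]; first by rewrite -vE; lra.
by rewrite !inE ffunE => /andP[/negbTE->].
Qed.

(** No demanded bundle is kept: the total excess of [a] over the prices [w] bounds the utility of
    every bundle, as the greedy argument requires. *)
Definition demand_support v w a :=
  additive_below v a /\
  forall B, v B - \sum_(j in B) w j <= \sum_j Num.max 0 (a j - w j).

Definition bid_vector v w : {ffun 'I_m -> R} :=
  xget [ffun=> 0] [set a | demand_support v w a]%classic.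

(** Take [a] supporting a utility-maximizing bundle [B]: the utility of [B] is the sum of
    [a j - w j] over [B], hence at most the sum of all positive parts. *)
Lemma bid_vectorP v w : supported v -> demand_support v w (bid_vector v w).
Proof.
move=> vs; apply: (@xgetPex _ _ [set a | demand_support v w a]%classic).
pose u B := v B - \sum_(j in B) w j.
pose B := [arg max_(B > finset.set0 : {set 'I_m}) u B]%O.
have Bmax C : u C <= u B.
  by rewrite /B; case: arg_maxP => // D _; apply.
have [a av vB] := vs B; exists a; split=> // C.
apply: (le_trans (Bmax C)); rewrite /u vB -sumrB big_mkcond.
by apply: ler_sum => j _; case: ifP => _; rewrite le_max ?lexx ?orbT.
Qed.

Fixpoint price (u : nat -> setfun R m) (t : nat) : {ffun 'I_m -> R} :=
  if t is t'.+1 then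
    [ffun j => Num.max (price u t' j) (bid_vector (u t') (price u t') j)]
  else [ffun=> 0].

Lemma price_ext u u' t : (forall i, (i < t)%N -> u i = u' i) ->
  price u t = price u' t.
Proof.
elim: t => //= t IH uu'; rewrite IH => [|i it]; last by apply: uu'; lia.
by rewrite uu'.
Qed.

Lemma price_mono u t t' j : (t <= t')%N -> price u t j <= price u t' j.
Proof.
move=> /subnK <-; elim: (t' - t)%N => //= k IH.
by rewrite ffunE le_max IH.
Qed.

Lemma price_ge0 u t j : 0 <= price u t j.
Proof. by apply: le_trans (price_mono u j (leq0n t)); rewrite ffunE. Qed.

(* Each arrival raises the total price by at least its utility for [A i] at the
   final prices, and disjoint sets pay the final prices at most once. *)
Lemma price_greedy u s (A : nat -> {set 'I_m}) :
  (forall i, (i < s)%N -> supported (u i)) ->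
  (forall i i', (i < s)%N -> (i' < s)%N -> i != i' -> [disjoint A i & A i']) ->
  \sum_(i < s) u i (A i) <= 2 * \sum_j price u s j.
Proof.
move=> us dA.
have gain i : (i < s)%N ->
    u i (A i) - \sum_(j in A i) price u s j <=
    \sum_j price u i.+1 j - \sum_j price u i j.
  move=> lis; have [_ /(_ (A i))] := bid_vectorP (price u i) (us _ lis).
  move=> H; apply: (@le_trans _ _ (u i (A i) - \sum_(j in A i) price u i j)).
    by rewrite lerD2l lerN2; apply: ler_sum => j _; apply: price_mono; lia.
  apply: (le_trans H); rewrite -sumrB; apply: ler_sum => j _ /=.
  by rewrite ffunE !maxEle; do 2![case: ifP]; lra.
have tele : \sum_(i < s) (\sum_j price u i.+1 j - \sum_j price u i j) =
    \sum_j price u s j.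
  rewrite -(big_mkord xpredT (fun i => \sum_j price u i.+1 j - \sum_j price u i j)).
  rewrite telescope_sumr // [X in _ - X]big1 ?subr0 // => j _.
  by rewrite /= ffunE.
have pay : \sum_(i < s) \sum_(j in A i) price u s j <= \sum_j price u s j.
  under eq_bigr do rewrite big_mkcond.
  rewrite exchange_big; apply: ler_sum => j _ /=.
  have [/existsP[i0 ji0]|/existsPn H] := boolP [exists i : 'I_s, j \in A i].
    rewrite (bigD1 i0) //= ji0 big1 ?addr0 // => i ii0.
    case: ifP => // ji; have /disjointFr := dA i i0 (ltn_ord i) (ltn_ord i0) ii0.
    by move=> /(_ _ ji); rewrite ji0.
  by rewrite big1 ?price_ge0 // => i _; rewrite (negbTE (H i)).
have : \sum_(i < s) (u i (A i) - \sum_(j in A i) price u s j) <=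
    \sum_(i < s) (\sum_j price u i.+1 j - \sum_j price u i j).
  by apply: ler_sum => i _; apply: gain.
rewrite tele sumrB; lra.
Qed.

End Supports.

(** * Single-item competition under random exchanges *)

Section UniqueWinner.
Context {d : Order.disp_t} {K : orderType d} {R : realDomainType} {s : nat}.
Implicit Types (X Y : 'I_s -> K) (c : {set 'I_s}) (t : 'I_s).

Definition wins X Y t := [forall t', Y t' < X t]%O.

(** Every [t] with [wins X Y t] will claim the item; a sole claimant gets it in any arrival
    order. *)
Definition unique_winner X Y t :=
  wins X Y t && [forall t', wins X Y t' ==> (t' == t)].

Definition unique_gain (f : K -> R) X Y := \sum_(t | unique_winner X Y t) f (X t).

Definition mix c X Y t := if t \in c then Y t else X t.

Lemma unique_gain_ge0 f X Y : (forall z, 0 <= f z) -> 0 <= unique_gain f X Y.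
Proof. by move=> f0; apply: sumr_ge0. Qed.

Definition toggle t c : {set 'I_s} := [set t' | (t' \in c) (+) (t' == t)].

Lemma toggleK t : involutive (toggle t).
Proof. by move=> c; apply/finset.setP => t'; rewrite !inE addbK. Qed.

Lemma mix_toggle t c X Y : mix (toggle t c) X Y t = mix c Y X t.
Proof. by rewrite /mix inE eqxx addbT; case: (t \in c). Qed.

Lemma mix_toggle_neq t t' c X Y : t' != t ->
  mix (toggle t c) X Y t' = mix c X Y t'.
Proof. by move=> /negbTE tt'; rewrite /mix inE tt' addbF. Qed.

(** The maps [phi], [psi] and their composite are bijections, so the four terms have equal
    totals. *)
Lemma sum_involutions4 (T : finType) (phi psi : T -> T) (F : T -> R) (M : R) :
  involutive phi -> involutive psi ->
  (forall z, M <= F z + F (phi z) + F (psi z) + F (psi (phi z))) ->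
  M *+ #|T| <= 4 * \sum_z F z.
Proof.
move=> phiK psiK H.
have E (g : T -> T) : injective g -> \sum_z F (g z) = \sum_z F z.
  by move=> gI; rewrite [RHS](reindex_inj gI).
rewrite -sumr_const.
apply: (@le_trans _ _ (\sum_z (F z + F (phi z) + F (psi z) + F (psi (phi z))))).
  by apply: ler_sum => z _; apply: H.
have phiI := can_inj phiK; have psiI := can_inj psiK.
rewrite !big_split /= (E phi) // (E psi) // (E (psi \o phi)); first lra.
exact: inj_comp.
Qed.

(* If the overall largest key sits among the [X]s and the largest remaining key
   (at another index) among the [Y]s, then the former is the unique winner;
   toggling these two indices reaches such a configuration from every [c]. *)
Lemma unique_gain_mix f X Y t0 :
  (forall z, 0 <= f z) -> {homo f : z z' / (z <= z')%O >-> z <= z'} ->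
  injective X -> injective Y -> (forall t t', X t != Y t') ->
  f (X t0) *+ 2 ^ s <= 4 * \sum_c unique_gain f (mix c X Y) (mix c Y X).
Proof.
move=> f0 fmono Xinj Yinj XY.
pose Z t := Order.max (X t) (Y t).
have Xle c t : (mix c X Y t <= Z t)%O.
  by rewrite /mix; case: ifP; rewrite le_max lexx ?orbT.
have Yle c t : (mix c Y X t <= Z t)%O.
  by rewrite /mix; case: ifP; rewrite le_max lexx ?orbT.
have Zmix c t : mix c X Y t <> Z t -> mix c Y X t = Z t.
  by rewrite /mix /Z maxEle; case: ifP; case: ifP.
have mixneq c t t' : mix c X Y t != mix c Y X t'.
  rewrite /mix; case: ifP => tc; case: ifP => t'c //; first by rewrite eq_sym.
    by rewrite (inj_eq Yinj); apply/negP => /eqP tt'; rewrite tt' t'c in tc.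
  by rewrite (inj_eq Xinj); apply/negP => /eqP tt'; rewrite tt' t'c in tc.
pose t1 := [arg max_(t > t0) Z t]%O.
have Zt1 t : (Z t <= Z t1)%O by rewrite /t1; case: arg_maxP => // i _; apply.
pose G c := unique_gain f (mix c X Y) (mix c Y X).
have G0 c : 0 <= G c by apply: unique_gain_ge0.
have good c : mix c X Y t1 = Z t1 ->
    (forall t, t != t1 -> exists t2, (mix c X Y t <= mix c Y X t2)%O) ->
    f (X t0) <= G c.
  move=> top snd; rewrite /G /unique_gain (bigD1 t1) /=.
    rewrite top; apply: ler_wpDr; first exact: sumr_ge0.
    by apply: fmono; apply: le_trans (Zt1 t0); rewrite le_max lexx.
  apply/andP; split.
    apply/forallP => t; rewrite lt_neqAle eq_sym mixneq top.
    exact: le_trans (Yle _ _) (Zt1 _).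
  apply/forallP => t; apply/implyP => /forallP tw; apply/eqP.
  apply: contrapT => /eqP /snd[t2]; rewrite leNgt => /negP; apply; exact: tw.
(* [psi] toggles an index [t2] carrying the largest key outside [t1], and so leaves [t1] alone. If
   [t1] is the only index, the identity serves. *)
have [psi psiK psiP] : exists2 psi : {set 'I_s} -> {set 'I_s}, involutive psi &
    forall c, mix c X Y t1 = Z t1 -> f (X t0) <= G c \/ f (X t0) <= G (psi c).
  have [/existsP[t' t't1]|/existsPn no] := boolP [exists t, t != t1]; last first.
    exists id => // c top; left; apply: good => // t tt1.
    by have := no t; rewrite tt1.
  pose t2 := [arg max_(t > t' | t != t1) Z t]%O.
  have [t2t1 Zt2] : t2 != t1 /\ forall t, t != t1 -> (Z t <= Z t2)%O.
    by rewrite /t2; case: arg_maxP => // i it1 H; split.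
  exists (toggle t2) => [|c top]; first exact: toggleK.
  have [top2|/Zmix top2] := pselect (mix c X Y t2 = Z t2); [right|left].
    apply: good => [|t tt1]; first by rewrite mix_toggle_neq // eq_sym.
    by exists t2; rewrite mix_toggle top2; apply: le_trans (Xle _ _) (Zt2 _ tt1).
  apply: good => // t tt1.
  by exists t2; rewrite top2; apply: le_trans (Xle _ _) (Zt2 _ tt1).
have -> : (2 ^ s = #|{set 'I_s}|)%N.
  by rewrite -cardsT -finset.powersetT card_powerset cardsT card_ord.
apply: (sum_involutions4 (phi := toggle t1) (psi := psi) (F := G)) => //.
  exact: toggleK.
move=> c; have := G0 c; have := G0 (toggle t1 c); have := G0 (psi c).
have := G0 (psi (toggle t1 c)).
have [top|/Zmix top] := pselect (mix c X Y t1 = Z t1).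
  by case: (psiP c top); lra.
by case: (psiP (toggle t1 c)); rewrite ?mix_toggle //; lra.
Qed.

End UniqueWinner.

(** * Arrival permutations and exchangeability of positions *)

Section Permutations.
Context {R : realFieldType} {n : nat}.

Definition pos (x : 'S_n.+1) (i : nat) : 'I_n.+1 := x (inord i).

Lemma pos_inj x i i' : (i <= n)%N -> (i' <= n)%N ->
  (pos x i == pos x i') = (i == i').
Proof.
move=> ni ni'; rewrite (inj_eq perm_inj); apply/eqP/eqP => [|->//].
by move/(congr1 val); rewrite /= !inordK.
Qed.

(** By transpositions all positions give the same total, and for each permutation the sum over all
    positions is the sum of [g]. *)
Lemma sum_perm_pos (g : 'I_n.+1 -> R) (i : nat) :
  n.+1%:R * \sum_x g (pos x i) = (n.+1)`!%:R * \sum_i g i.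
Proof.
have E (a : 'I_n.+1) : \sum_(x : 'S_n.+1) g (x a) = \sum_x g (pos x i).
  rewrite (reindex_inj (mulgI (tperm a (inord i)))) /=.
  by apply: eq_bigr => x _; rewrite permM tpermL.
rewrite mulr_natl -[X in _ *+ X](card_ord n.+1) -sumr_const.
rewrite (eq_bigr _ (fun a _ => esym (E a))) exchange_big /=.
rewrite (eq_bigr (fun=> \sum_i g i)) => [|x _].
  by rewrite sumr_const card_Sn mulr_natl.
by rewrite [RHS](reindex_inj (@perm_inj _ x)).
Qed.

(** Exchangeability: precomposition with the involution [g] of positions is a bijection of the
    permutations. *)
Lemma sum_perm_reindex (F F' : 'S_n.+1 -> R) (g : nat -> nat) :
  (forall i, (i <= n)%N -> (g i <= n)%N) ->
  (forall i, (i <= n)%N -> g (g i) = i) ->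
  (forall x x', (forall i, (i <= n)%N -> pos x' i = pos x (g i)) ->
    F x' = F' x) ->
  \sum_x F x = \sum_x F' x.
Proof.
move=> gn gK FF'.
have gI : injective (fun i : 'I_n.+1 => inord (g i) : 'I_n.+1).
  move=> i i' /(congr1 val); have ni := gn _ (leq_ord i); have ni' := gn _ (leq_ord i').
  rewrite /= !inordK // => /(congr1 g).
  by rewrite !gK ?leq_ord // => /val_inj.
rewrite (reindex_inj (mulgI (perm gI))) /=; apply: eq_bigr => x _; apply: FF'.
by move=> i ni; rewrite /pos permM permE inordK.
Qed.

End Permutations.

(** * Averages over arrival permutations *)

Section Averages.
Context {R : realType} {n m : nat} (v : 'I_n.+1 -> setfun R m) (s k : nat).
Hypotheses (sk : (s + s <= k)%N) (kn : (k + s <= n.+1)%N).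
Hypothesis vs : forall i, supported (v i).
Implicit Types (y : nat -> 'I_n.+1) (x : 'S_n.+1).

Fixpoint running_max (a : nat -> R) (t : nat) : R :=
  if t is t'.+1 then Num.max (running_max a t') (a t') else 0.

Lemma running_max_ext a b t : (forall i, (i < t)%N -> a i = b i) ->
  running_max a t = running_max b t.
Proof.
elim: t => //= t IH ab; rewrite IH => [|i it]; last by apply: ab; lia.
by rewrite ab.
Qed.

Lemma running_max_le a t z : 0 <= z -> (forall i, (i < t)%N -> a i <= z) ->
  running_max a t <= z.
Proof.
move=> z0; elim: t => //= t IH az.
by rewrite ge_max IH ?az // => i it; apply: az; lia.
Qed.

Lemma max_increment (a b p q : R) :
  Num.max (Num.max p a) (Num.max q b) - Num.max p q <=
  Num.max 0 (a - Num.max p q) + Num.max 0 (b - Num.max p q).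
Proof. by rewrite !maxEle; do !case: ifP; lra. Qed.

Lemma increment_le_max (b p q : R) :
  Num.max 0 (b - Num.max p q) <= Num.max q b - q.
Proof. by rewrite !maxEle; do !case: ifP; lra. Qed.

Definition bid y (j : 'I_m) (t : nat) (i : 'I_n.+1) : R :=
  bid_vector (v i) (price (v \o y) t) j.

Lemma bid_ext y y' j t i : (forall l, (l < t)%N -> y l = y' l) ->
  bid y j t i = bid y' j t i.
Proof. by move=> yy'; rewrite /bid (@price_ext _ _ _ (v \o y')) // => l /yy' /= ->. Qed.

Lemma bid_ge0 y j t i : 0 <= bid y j t i.
Proof. by have [[a0 _] _] := bid_vectorP (price (v \o y) t) (vs i); apply: a0. Qed.

Lemma price_running_max y j t :
  price (v \o y) t j = running_max (fun l => bid y j l (y l)) t.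
Proof.
by elim: t => [|t IH] /=; rewrite ffunE ?IH.
Qed.

(* Decoupling of tangent sequences: the buyers in positions [t] and [k + t] are
   exchangeable given everything before, so the running maximum over both
   sequences receives equal expected contributions from either of them. *)
Lemma sum_price_le_tangent (j : 'I_m) :
  \sum_x price (v \o pos x) s j <=
  2 * \sum_x running_max (fun t => bid (pos x) j t (pos x (k + t)%N)) s.
Proof.
pose alpha x t := bid (pos x) j t (pos x t).
pose beta x t := bid (pos x) j t (pos x (k + t)%N).
pose N x t := Num.max (running_max (alpha x) t) (running_max (beta x) t).
have NS x t : N x t.+1 - N x t <=
    Num.max 0 (alpha x t - N x t) + Num.max 0 (beta x t - N x t).
  exact: max_increment.
have swap (t : nat) : (t < s)%N ->
    \sum_x Num.max 0 (alpha x t - N x t) = \sum_x Num.max 0 (beta x t - N x t).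
  move=> ts.
  apply: (@sum_perm_reindex _ _ _ _
    (fun i => if i == t then (k + t)%N else if i == (k + t)%N then t else i)).
  - by move=> i; do 2?case: eqP => _; lia.
  - move=> i _; have [->|it] := eqVneq i t; first by rewrite eqxx; case: eqP; lia.
    have [->|ikt] := eqVneq i (k + t)%N; first by rewrite eqxx.
    by rewrite (negbTE it) (negbTE ikt).
  move=> x x' xx'.
  (* Only [t] and [k + t] are moved, while [N x t] and the prices at time [t] depend on positions
     below [t] and from [k] to [k + t - 1]. *)
  have eqpos i : (i < t)%N || (k <= i < k + t)%N -> pos x' i = pos x i.
    by move=> it; rewrite xx'; last lia; do 2?case: eqP; rewrite //; lia.
  have -> : alpha x' t = beta x t.
    rewrite /alpha /beta xx'; last lia.
    by rewrite eqxx; apply: bid_ext => l lt; apply: eqpos; lia.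
  congr (Num.max 0 (_ - Num.max _ _)).
    apply: running_max_ext => i it; rewrite /alpha eqpos ?it //.
    by apply: bid_ext => l lt; apply: eqpos; lia.
  apply: running_max_ext => i it; rewrite /beta eqpos; last lia.
  by apply: bid_ext => l lt; apply: eqpos; lia.
apply: (@le_trans _ _ (\sum_x N x s)).
  by apply: ler_sum => x _; rewrite price_running_max le_max lexx.
have -> : \sum_x N x s = \sum_x \sum_(t < s) (N x t.+1 - N x t).
  apply: eq_bigr => x _.
  rewrite -(big_mkord xpredT (fun t => N x t.+1 - N x t)) telescope_sumr //.
  by rewrite /N /= maxxx subr0.
apply: (@le_trans _ _ (2 * \sum_x \sum_(t < s) Num.max 0 (beta x t - N x t))).
  rewrite mulr_natl mulr2n.
  rewrite exchange_big [X in _ <= X + _]exchange_big [X in _ <= _ + X]exchange_big /=.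
  rewrite -big_split /=; apply: ler_sum => t _.
  rewrite -{1}(swap t (ltn_ord t)) -big_split /=.
  by apply: ler_sum => x _; apply: NS.
rewrite ler_wpM2l //; apply: ler_sum => x _.
apply: (@le_trans _ _ (\sum_(t < s)
    (running_max (beta x) t.+1 - running_max (beta x) t))).
  by apply: ler_sum => t _; apply: increment_le_max.
rewrite -(big_mkord xpredT
  (fun t => running_max (beta x) t.+1 - running_max (beta x) t)).
by rewrite telescope_sumr // subr0.
Qed.

(* Buyer identities break ties between equal bids. *)
Definition offer y (j : 'I_m) (t : nat) (i : 'I_n.+1) : (R *l 'I_n.+1)%type :=
  (bid y j t i, i).

(** Index [t] pairs position [k + t] with position [s + t]. Both bid at prices made by positions
    below [t], so swapping the two changes no price. *)
Definition contender y j (t : 'I_s) := offer y j t (y (k + t)%N).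
Definition reserve y j (t : 'I_s) := offer y j t (y (s + t)%N).
Definition amount (z : (R *l 'I_n.+1)%type) : R := z.1.
Definition gain y j := unique_gain amount (contender y j) (reserve y j).

Definition mem_pos (c : {set 'I_s}) (i : nat) : bool :=
  if insub i is Some t then t \in c else false.

Lemma mem_pos_ord c (t : 'I_s) : mem_pos c t = (t \in c).
Proof. by rewrite /mem_pos valK. Qed.

Lemma mem_pos_ge c i : (s <= i)%N -> mem_pos c i = false.
Proof. by move=> si; rewrite /mem_pos insubN // -leqNgt. Qed.

(** The involution of positions that realizes [mix c]: [s + t] and [k + t] trade places for [t] in
    [c]. *)
Definition exchange c (i : nat) : nat :=
  if (s <= i)%N && mem_pos c (i - s) then (i - s + k)%N
  else if (k <= i)%N && mem_pos c (i - k) then (i - k + s)%N else i.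

Lemma exchange_contender c (t : 'I_s) :
  exchange c (k + t)%N = if t \in c then (s + t)%N else (k + t)%N.
Proof.
rewrite /exchange mem_pos_ge ?andbF; last by lia.
by rewrite leq_addr addKn mem_pos_ord /=; case: ifP => // _; lia.
Qed.

Lemma exchange_reserve c (t : 'I_s) :
  exchange c (s + t)%N = if t \in c then (k + t)%N else (s + t)%N.
Proof.
rewrite /exchange leq_addr addKn mem_pos_ord /=; case: ifP => // _.
  by lia.
by case: ifP => // /andP[]; have := ltn_ord t; lia.
Qed.

Lemma exchange_low c i : (i < s)%N -> exchange c i = i.
Proof. by rewrite /exchange => si; do 2?case: ifP => //; lia. Qed.

Lemma exchange_le c i : (i <= n)%N -> (exchange c i <= n)%N.
Proof.
rewrite /exchange => ni; case: ifP => [/andP[si]|_].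
  by case: (ltnP (i - s) s) => [|/mem_pos_ge -> //]; lia.
by case: ifP => //; lia.
Qed.

Lemma exchangeK c i : exchange c (exchange c i) = i.
Proof.
have [ilts|sli] := ltnP i s; first by rewrite !exchange_low // exchange_low.
have [is2|s2i] := ltnP i (s + s).
  have lt : (i - s < s)%N by lia.
  rewrite -(subnKC sli) -[(i - s)%N]/(val (Ordinal lt)) exchange_reserve.
  by case: ifP => tc; rewrite ?exchange_contender ?exchange_reserve tc.
have [ik|ki] := ltnP i k.
  have E : exchange c i = i.
    by rewrite /exchange mem_pos_ge ?andbF; [case: ifP; lia|lia].
  by rewrite !E.
have [iks|ksi] := ltnP i (k + s).
  have lt : (i - k < s)%N by lia.
  rewrite -(subnKC ki) -[(i - k)%N]/(val (Ordinal lt)) exchange_contender.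
  by case: ifP => tc; rewrite ?exchange_contender ?exchange_reserve tc.
have E : exchange c i = i.
  by rewrite /exchange !mem_pos_ge ?andbF; lia.
by rewrite !E.
Qed.

(** No exchange alters the total gain over all permutations, so it may be averaged over the [2 ^ s]
    sets [c]. For a fixed permutation [unique_gain_mix] bounds this average below by a quarter of
    the largest contending bid. *)
Lemma sum_tangent_le_gain (j : 'I_m) :
  \sum_x running_max (fun t => bid (pos x) j t (pos x (k + t)%N)) s <=
  4 * \sum_x gain (pos x) j.
Proof.
pose X x := contender (pos x) j; pose Y x := reserve (pos x) j.
pose f := amount.
(* [unique_gain_mix] asks for a weight nonnegative on all keys; as bids are nonnegative, clipping at
   0 changes no gain. *)
pose f0 := (fun z => Num.max 0 z.1) : (R *l 'I_n.+1)%type -> R.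
have gainE x c : unique_gain f0 (mix c (X x) (Y x)) (mix c (Y x) (X x)) =
    unique_gain f (mix c (X x) (Y x)) (mix c (Y x) (X x)).
  apply: eq_bigr => t _; rewrite /f0 /f /amount /mix; apply: max_idPr.
  by case: ifP => _; apply: bid_ge0.
have swapE c : \sum_x gain (pos x) j =
    \sum_x unique_gain f (mix c (X x) (Y x)) (mix c (Y x) (X x)).
  apply: (@sum_perm_reindex _ _ _ _ (exchange c)) => [i|i _|x x' xx'].
  - exact: exchange_le.
  - exact: exchangeK.
  rewrite /gain.
  have xx'E t l : (l < t)%N -> (t < s)%N -> pos x' l = pos x l.
    by move=> lt ts; rewrite xx' ?exchange_low //; lia.
  have -> : contender (pos x') j = mix c (X x) (Y x).
    apply/funext => t; rewrite /contender /offer xx'; last first.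
      by have := ltn_ord t; lia.
    rewrite exchange_contender /mix /X /Y /contender /reserve /offer.
    by case: ifP => _; congr (_, _); apply: bid_ext => l lt; apply: (xx'E t).
  have -> // : reserve (pos x') j = mix c (Y x) (X x).
  apply/funext => t; rewrite /reserve /offer xx'; last first.
    by have := ltn_ord t; lia.
  rewrite exchange_reserve /mix /X /Y /contender /reserve /offer.
  by case: ifP => _; congr (_, _); apply: bid_ext => l lt; apply: (xx'E t).
have win x : running_max (fun t => bid (pos x) j t (pos x (k + t)%N)) s *+ 2 ^ s <=
    4 * \sum_c unique_gain f (mix c (X x) (Y x)) (mix c (Y x) (X x)).
  have U0 : 0 <= 4 * \sum_c unique_gain f (mix c (X x) (Y x)) (mix c (Y x) (X x)).
    rewrite mulr_ge0 // sumr_ge0 // => c _; rewrite -gainE unique_gain_ge0 // => z.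
    by rewrite /f0 le_max lexx.
  rewrite -[X in X <= _]mulr_natr -ler_pdivlMr ?ltr0n ?expn_gt0 //.
  apply: running_max_le => [|t ts]; first by rewrite divr_ge0.
  rewrite ler_pdivlMr ?ltr0n ?expn_gt0 // mulr_natr.
  rewrite -(eq_bigr _ (fun c _ => gainE x c)).
  have -> : bid (pos x) j t (pos x (k + t)%N) = f0 (X x (Ordinal ts)).
    by rewrite /f0 /= max_r // bid_ge0.
  have lt (u : 'I_s) := ltn_ord u.
  have pinj i i' (a b : R) : (i <= n)%N -> (i' <= n)%N ->
      (a, pos x i) = (b, pos x i') -> i = i'.
    by move=> ni ni' [_ /eqP]; rewrite pos_inj // => /eqP.
  apply: unique_gain_mix.
  - by move=> z; rewrite /f0 le_max lexx.
  - move=> [a1 a2] [b1 b2]; rewrite lexi_pair => /andP[ab _].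
    by rewrite /f0 /= ge_max le_max lexx /= le_max ab orbT.
  - move=> u u'; have := lt u; have := lt u' => ? ? /pinj H.
    apply/val_inj => /=; have : (k + u = k + u')%N by apply: H; lia.
    lia.
  - move=> u u'; have := lt u; have := lt u' => ? ? /pinj H.
    apply/val_inj => /=; have : (s + u = s + u')%N by apply: H; lia.
    lia.
  - move=> u u'; have := lt u; have := lt u' => ? ?; apply/eqP => /pinj H.
    have : (k + u = s + u')%N by apply: H; lia.
    lia.
have s2 : 0 < (2 ^ s)%:R :> R by rewrite ltr0n expn_gt0.
rewrite -(ler_pM2r s2) mulr_suml -mulrA.
apply: (@le_trans _ _ (\sum_x 4 * \sum_c
    unique_gain f (mix c (X x) (Y x)) (mix c (Y x) (X x)))).
  by apply: ler_sum => x _; rewrite mulr_natr.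
rewrite -mulr_sumr ler_pM2l // exchange_big /=.
rewrite -(eq_bigr _ (fun c _ => swapE c)) sumr_const mulr_natr.
by rewrite -[#|_|]cardsT -finset.powersetT card_powerset cardsT card_ord.
Qed.

(** The first [s] positions hold on average a share [s / n.+1] of [welfare v A]. The factor 16 is 2
    from [price_greedy], 2 from decoupling and 4 from the unique winner. *)
Lemma sum_welfare_le_gain (A : 'I_n.+1 -> {set 'I_m}) :
  pairwise_disjoint A ->
  (s * (n.+1)`!)%:R * welfare v A <=
  n.+1%:R * (16 * \sum_x \sum_j gain (pos x) j).
Proof.
move=> /forallP dA.
have greedy x : \sum_(t < s) v (pos x t) (A (pos x t)) <=
    2 * \sum_j price (v \o pos x) s j.
  apply: (price_greedy (u := v \o pos x) (A := A \o pos x)) => [i _|i i' si si' ii'] /=.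
    exact: vs.
  apply: (implyP (forallP (dA _) _)).
  by rewrite pos_inj //; lia.
have -> : (s * (n.+1)`!)%:R * welfare v A =
    n.+1%:R * \sum_x \sum_(t < s) v (pos x t) (A (pos x t)).
  rewrite exchange_big [RHS]mulr_sumr /=.
  rewrite [RHS](eq_bigr (fun=> (n.+1)`!%:R * welfare v A)) => [|t _].
    by rewrite sumr_const card_ord natrM -mulrA -[RHS]mulr_natl.
  exact: (sum_perm_pos (fun i => v i (A i))).
rewrite ler_pM2l ?ltr0n //.
apply: (@le_trans _ _ (\sum_x 2 * \sum_j price (v \o pos x) s j)).
  by apply: ler_sum => x _; apply: greedy.
rewrite -mulr_sumr exchange_big [X in _ <= _ * X]exchange_big /=.
rewrite [16](_ : _ = 2 * 8); last by ring.
rewrite -mulrA ler_pM2l // mulr_sumr; apply: ler_sum => j _.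
have := sum_price_le_tangent j; have := sum_tangent_le_gain j; lra.
Qed.

End Averages.

(** * Random ranking of a random sample *)

Section Ranking.
Context {n : nat}.
Implicit Types (sigma tau : 'S_n) (S : {set 'I_n}).

Definition ranked (T : Type) (key : T -> 'I_n) sigma : seq T -> seq T :=
  sort (fun a b => sigma (key a) <= sigma (key b))%N.

(** The place of an unsampled buyer is determined by [sigma] and the sample alone, so it is known on
    arrival and does not depend on the arrival order. *)
Definition ranking sigma S : seq 'I_n :=
  ranked id sigma (enum S) ++ ranked id sigma (enum (~: S)).

Lemma perm_ranking sigma S : perm_eq (ranking sigma S) (enum 'I_n).
Proof.
apply: uniq_perm; rewrite ?enum_uniq //.
  rewrite cat_uniq !sort_uniq !enum_uniq andbT /=.
  by apply/hasPn => i; rewrite !mem_sort !mem_enum inE.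
by move=> i; rewrite mem_cat !mem_sort !mem_enum !inE; case: (i \in S).
Qed.

Lemma size_ranking sigma S : size (ranking sigma S) = n.
Proof. by rewrite (perm_size (perm_ranking sigma S)) size_enum_ord. Qed.

Lemma ranking_uniq sigma S : uniq (ranking sigma S).
Proof. by rewrite (perm_uniq (perm_ranking sigma S)) enum_uniq. Qed.

Lemma ranking_inj sigma S : injective (fun i : 'I_n => nth i (ranking sigma S) i).
Proof.
move=> i i'; rewrite (set_nth_default i) ?size_ranking // => /eqP.
by rewrite nth_uniq ?size_ranking ?ranking_uniq // => /eqP /val_inj.
Qed.

Definition rank_perm sigma S : 'S_n := perm (@ranking_inj sigma S).

Lemma ranked_act tau sigma S :
  ranked id (tau^-1 * sigma)%g (enum (tau @: S)) =
  [seq tau i | i <- ranked id sigma (enum S)].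
Proof.
have -> : ranked id sigma (enum S) =
    sort (relpre tau (fun a b => (tau^-1 * sigma)%g a <= (tau^-1 * sigma)%g b)%N)
      (enum S).
  by congr (sort _ _); apply/funext => a; apply/funext => b; rewrite /= !permM !permK.
rewrite -sort_map; apply/perm_sortP.
- by move=> a b; apply: leq_total.
- by move=> a b c; apply: leq_trans.
- by move=> a b /anti_leq /val_inj; apply: perm_inj.
apply: uniq_perm; rewrite ?enum_uniq ?map_inj_uniq ?enum_uniq //.
  exact: perm_inj.
move=> i; rewrite mem_enum; apply/finset.imsetP/mapP.
  by case=> a aS ->; exists a; rewrite ?mem_enum.
by case=> a; rewrite mem_enum => aS ->; exists a.
Qed.

(** Equivariance under relabelling of the buyers; it makes a uniform sample ranked by a uniform
    [sigma] a uniform permutation. *)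
Lemma rank_perm_act tau sigma S :
  rank_perm (tau^-1 * sigma)%g (tau @: S) = (rank_perm sigma S * tau)%g.
Proof.
apply/permP => i; rewrite permM !permE.
have setCE : ~: (tau @: S) = tau @: (~: S).
  apply/finset.setP => a; rewrite inE -[a](permKV tau).
  by rewrite !(mem_imset _ _ (@perm_inj _ tau)) inE.
have -> : ranking (tau^-1 * sigma)%g (tau @: S) =
    [seq tau a | a <- ranking sigma S].
  by rewrite /ranking map_cat -!ranked_act setCE.
by rewrite (nth_map i) // size_ranking.
Qed.

Lemma sum_rank_perm (R : realFieldType) (k : nat) (G : 'S_n -> R) :
  \sum_(S : {set 'I_n} | #|S| == k) \sum_sigma G (rank_perm sigma S) =
  'C(n, k)%:R * \sum_x G x.
Proof.
have N0 : #|{: 'S_n}|%:R != 0 :> R.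
  by rewrite card_Sn pnatr_eq0 -lt0n fact_gt0.
apply: (mulfI N0); rewrite [LHS]mulr_natl -[LHS]sumr_const.
(* Relabelling by [tau] permutes the pairs of [S] and [sigma], so each [tau] contributes the
   original sum. For fixed [S] and [sigma] the product runs over all permutations. *)
transitivity (\sum_(S : {set 'I_n} | #|S| == k) \sum_(sigma : 'S_n)
    \sum_(tau : 'S_n) G (rank_perm sigma S * tau)%g).
  under [RHS]eq_bigr do rewrite exchange_big.
  rewrite [RHS]exchange_big /=; apply: eq_big => [//|tau _].
  rewrite (reindex_inj (imset_inj (@perm_inj _ tau))) /=.
  apply: eq_big => S; first by rewrite card_imset //; apply: perm_inj.
  move=> _; rewrite (reindex_inj (mulgI tau^-1%g)) /=.
  by apply: eq_bigr => sigma _; rewrite rank_perm_act.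
rewrite (eq_bigr (fun=> #|{: 'S_n}|%:R * \sum_x G x)) => [|S _].
  rewrite sumr_const -[LHS]mulr_natl [LHS]mulrCA; congr (_ * (_%:R * _)).
  by rewrite -cardsE card_draws card_ord.
rewrite (eq_bigr (fun=> \sum_x G x)) ?sumr_const ?mulr_natl // => sigma _.
by rewrite [RHS](reindex_inj (mulgI (rank_perm sigma S))).
Qed.

End Ranking.

(** * The algorithm *)

Section Algorithm.
Context {R : realType}.

(* With fewer than three buyers, exactly one of them is not sampled. *)
Definition wanted (n m : nat) (sigma : 'S_n) (sample : seq (buyer R n m))
    (b : buyer R n m) : {set 'I_m} :=
  if (n < 3)%N then [set: 'I_m] else
  let s := (n %/ 3)%N in
  let history := ranked fst sigma sample in
  let t := index b.1 (ranked id sigma (enum [pred i | i \notin unzip1 sample])) in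
  let tender j t' (b' : buyer R n m) : (R *l 'I_n)%type :=
    (bid_vector b'.2 (price (fun l => (nth b history l).2) t') j, b'.1) in
  if (t < s)%N then
    [set j | [forall t' : 'I_s,
                tender j t' (nth b history (s + t')) < tender j t b]%O]
  else finset.set0.

(** The seeds below n factorial enumerate the permutations; the others will have probability 0. *)
Definition seed_perm (n w : nat) : 'S_n := nth 1%g (enum 'S_n) w.

End Algorithm.

Section Serve.
Context {R : realType} {n m : nat} (alg : secretary_algorithm R n m).
Variables (w : seed alg) (sample : seq (buyer R n m)).
Variables (wants : buyer R n m -> {set 'I_m}) (v : 'I_n -> setfun R m).
Hypothesis decideE : forall past b avail,
  decide w sample past b avail = avail :&: wants b.

(** Earlier arrivals take only what they want, so an item wanted by one arrival alone is still
    available when that buyer comes. *)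
Lemma serve_unique past (avail : {set 'I_m}) (l : seq 'I_n) i j :
  uniq l -> i \in l -> j \in avail -> j \in wants (i, v i) ->
  (forall i', i' \in l -> i' != i -> j \notin wants (i', v i')) ->
  j \in serve w sample past avail (reveal v l) i.
Proof.
elim: l past avail => [|i0 l IH] past avail; first by rewrite in_nil.
rewrite cons_uniq => /andP[i0l ul] il javail jw other.
have [ii0|ii0] := eqVneq i i0.
  by rewrite /= decideE ii0 eqxx inE javail -ii0.
rewrite /= decideE (negbTE ii0); apply: IH => //.
- by move: il; rewrite in_cons (negbTE ii0).
- rewrite finset.in_setD javail andbT finset.in_setI negb_and orbC.
  by rewrite other ?in_cons ?eqxx // eq_sym.
- by move=> i' i'l; apply: other; rewrite in_cons i'l orbT.
Qed.

End Serve.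

Section UniformSeed.
Context {R : realType} (N : nat).

(** All sets of [nat] are measurable, so the measurability demanded of [decide] is immediate. The
    argument [N] stands for [N.+1] seeds. *)
Definition uniform_seed : set nat -> \bar R :=
  mscale (N.+1%:R^-1)%:nng (msum (fun i => \d_i) N.+1).

HB.instance Definition _ := Measure.on uniform_seed.

Lemma uniform_seed_setT : uniform_seed setT = 1%E.
Proof.
rewrite /uniform_seed /mscale /= /msum.
rewrite (eq_bigr (fun=> 1%E)) => [|i _]; last exact: diracT.
by rewrite sumEFin sumr_const card_ord -EFinM mulVf // pnatr_eq0.
Qed.

HB.instance Definition _ :=
  Measure_isProbability.Build _ _ _ uniform_seed uniform_seed_setT.

Lemma expectation_uniform_seed (X : nat -> R) : (forall w, 0 <= X w) ->
  expectation uniform_seed X = (N.+1%:R^-1 * \sum_(w < N.+1) X w)%:E.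
Proof.
move=> X0; have XE0 i : [set: nat]%classic i -> (0 <= (X i)%:E)%E by rewrite lee_fin.
rewrite unlock ge0_integral_mscale // ge0_integral_measure_sum //.
rewrite (eq_bigr (fun i : 'I_N.+1 => (X i)%:E)) => [|i _].
  by rewrite sumEFin EFinM.
by rewrite integral_dirac // diracT mul1e.
Qed.

End UniformSeed.

Definition sample_then_bid (R : realType) (n m : nat) : secretary_algorithm R n m :=
  @SecretaryAlgorithm R n m _ nat (@uniform_seed R (n`!).-1)
    (fun w sample past b avail => avail :&: wanted (seed_perm n w) sample b)
    (fun w sample past b avail => finset.subsetIl _ _)
    (fun sample past b avail A => I).

(** * Welfare for a fixed sample and a fixed seed *)

Section WelfareBound.
Context {R : realType} {n m : nat} (v : 'I_n.+1 -> setfun R m) (k : nat).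
Hypothesis (kn : (k <= n)%N).
Variables (order : {set 'I_n.+1} -> seq 'I_n.+1) (S : {set 'I_n.+1}) (w : nat).
Hypotheses (Sk : #|S| = k) (orderP : perm_eq (order S) (enum (~: S))).
Hypothesis vs : forall i, supported (v i).
Hypothesis v0 : forall i B, 0 <= v i B.

Let sigma := seed_perm n.+1 w.
Let x := rank_perm sigma S.
Let alloc := ALG (alg := sample_then_bid R n.+1 m) v S (order S) w.
Let wants i := wanted sigma (reveal v (enum S)) (i, v i).

Lemma pos_rank_perm i0 i : (i <= n)%N -> pos x i = nth i0 (ranking sigma S) i.
Proof.
move=> ni; rewrite /pos permE inordK //; apply: set_nth_default.
by rewrite size_ranking.
Qed.

Lemma size_ranked (T : Type) (key : T -> 'I_n.+1) (l : seq T) :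
  size (ranked key sigma l) = size l.
Proof. exact: size_sort. Qed.

Lemma pos_sample i0 i : (i < k)%N ->
  pos x i = nth i0 (ranked id sigma (enum S)) i.
Proof.
move=> ik; rewrite (pos_rank_perm i0) ?nth_cat ?size_ranked -?cardE ?Sk ?ik //.
by lia.
Qed.

Lemma pos_rest i0 i : (k + i <= n)%N ->
  pos x (k + i) = nth i0 (ranked id sigma (enum (~: S))) i.
Proof.
move=> ik; rewrite (pos_rank_perm i0) // nth_cat size_ranked -cardE Sk.
by rewrite ltnNge leq_addr /= addKn.
Qed.

Lemma size_rest : size (ranked id sigma (enum (~: S))) = (n.+1 - k)%N.
Proof. by rewrite size_ranked -cardE cardsCs finset.setCK card_ord Sk. Qed.

Lemma pos_restP i : reflect (exists2 t, (k + t <= n)%N & i = pos x (k + t)%N)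
  (i \in order S).
Proof.
have memE : (i \in order S) = (i \in ranked id sigma (enum (~: S))).
  by rewrite (perm_mem orderP) mem_sort.
rewrite memE; apply: (iffP (nthP i)); rewrite size_rest.
  move=> [t tk it]; have kt : (k + t <= n)%N by lia.
  by exists t => //; rewrite (pos_rest i).
move=> [t kt it]; exists t; first by lia.
by rewrite -(pos_rest i).
Qed.

Lemma mem_alloc i j : i \in order S -> j \in wants i ->
  (forall i', i' \in order S -> i' != i -> j \notin wants i') -> j \in alloc i.
Proof.
move=> iS jw other.
apply: (serve_unique (alg := sample_then_bid R n.+1 m)
  (wants := fun b => wanted sigma (reveal v (enum S)) b)) => //.
by rewrite (perm_uniq orderP) enum_uniq.
Qed.

Lemma welfare_few : (n.+1 < 3)%N -> k = n ->
  v (pos x k) [set: 'I_m] <= welfare v alloc.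
Proof.
move=> n3 kE; have iS : pos x k \in order S.
  by apply/pos_restP; exists 0%N; rewrite addn0 ?kE.
have allocT : alloc (pos x k) = [set: 'I_m].
  apply/finset.setP => j; rewrite inE; apply: mem_alloc => //.
    by rewrite /wants /wanted n3 inE.
  move=> i' /pos_restP[t tk ->]; rewrite (_ : t = 0%N) ?addn0 ?eqxx //; lia.
rewrite /welfare (bigD1 (pos x k)) //= allocT ler_wpDr // sumr_ge0 //.
Qed.

Let s := (n.+1 %/ 3)%N.

(** Identifies the rule computed from the revealed sample with the competition analysed over
    permutations; unsampled buyers of rank at least [s] want nothing. *)
Lemma mem_wants j t : (2 <= n)%N -> (s + s <= k)%N -> (k + t <= n)%N ->
  (j \in wants (pos x (k + t)%N)) =
  if insub t is Some t' then
    wins (contender v k (pos x) j) (reserve v (pos x) j) (t' : 'I_s)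
  else false.
Proof.
move=> n3 sk tk; rewrite /wants /wanted ifF; last by lia.
have -> : unzip1 (reveal v (enum S)) = enum S.
  by rewrite /unzip1 /reveal -map_comp map_id.
have -> : enum [pred i | i \notin enum S] = enum (~: S).
  by apply: eq_enum => i; rewrite !inE mem_enum.
have -> : ranked fst sigma (reveal v (enum S)) =
    reveal v (ranked id sigma (enum S)).
  by rewrite /ranked /reveal sort_map.
set b := (_, v _).
have nthE l : (l < k)%N ->
    nth b (reveal v (ranked id sigma (enum S))) l = (pos x l, v (pos x l)).
  move=> lk; rewrite (nth_map b.1) ?size_ranked -?cardE ?Sk //.
  by rewrite -pos_sample.
rewrite [index _ _](_ : _ = t); last first.
  rewrite /b /= (pos_rest ord0) // index_uniq ?size_rest ?sort_uniq ?enum_uniq //.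
  by lia.
rewrite -/s; case: insubP => [t' ts tt'|/negbTE->]; last by rewrite inE.
have priceE t0 : (t0 < s)%N ->
    price (fun l => (nth b (reveal v (ranked id sigma (enum S))) l).2) t0 =
    price (v \o pos x) t0.
  by move=> ts0; apply: price_ext => l lt; rewrite nthE //; lia.
rewrite ts inE /wins; apply: eq_forallb => u.
have us := ltn_ord u.
rewrite nthE; last by lia.
by rewrite !priceE // /reserve /contender /offer /bid /b tt'.
Qed.

(** A unique winner receives the item by [mem_alloc], and a buyer's bids, being additive and below
    the valuation, sum over the received set to at most its value. *)
Lemma welfare_many : (2 <= n)%N -> (s + s <= k)%N -> (k + s <= n.+1)%N ->
  \sum_j gain v s k (pos x) j <= welfare v alloc.
Proof.
move=> n3 sk ksn.
pose d (t : 'I_s) := pos x (k + t)%N.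
have dinj : injective d.
  move=> t t'; have := ltn_ord t; have := ltn_ord t' => ? ? /eqP.
  by rewrite pos_inj ?eqn_add2l; [move/eqP/val_inj|lia|lia].
apply: (@le_trans _ _ (\sum_(t < s) v (d t) (alloc (d t)))); last first.
  rewrite /welfare (bigID (mem (d @: 'I_s))) /= big_imset /=; last first.
    by move=> t t' _ _; apply: dinj.
  by rewrite ler_wpDr ?sumr_ge0.
have -> : \sum_j gain v s k (pos x) j = \sum_(t < s)
    \sum_(j | unique_winner (contender v k (pos x) j) (reserve v (pos x) j) t)
      bid v (pos x) j t (d t).
  by rewrite /gain /unique_gain (exchange_big_dep xpredT).
apply: ler_sum => t _; have ts := ltn_ord t.
have [[a0 aB] _] := bid_vectorP (price (v \o pos x) t) (vs (d t)).
apply: le_trans (aB (alloc (d t))).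
rewrite big_mkcond [X in _ <= X]big_mkcond /=.
apply: ler_sum => j _; case: ifP => [/andP[tw /forallP uniq]|_]; last first.
  by case: ifP => // _; apply: a0.
rewrite ifT // mem_alloc //.
- by apply/pos_restP; exists t => //; lia.
- by rewrite mem_wants //; [rewrite valK|lia].
move=> i' /pos_restP[u un ->] ud; rewrite mem_wants //.
case: insubP => [u' us uu'|//]; apply/negP => u'w.
have /eqP u't := implyP (uniq u') u'w.
by move: ud; rewrite /d -u't uu' eqxx.
Qed.

End WelfareBound.

(** * Expectation over samples and seeds *)

Section Competitive.
Context {R : realType}.

Lemma sum_seed_perm n (F : 'S_n -> R) :
  \sum_(w < (n`!).-1.+1) F (seed_perm n w) = \sum_sigma F sigma.
Proof.
rewrite prednK ?fact_gt0 // -(big_mkord xpredT (F \o seed_perm n)) /=.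
rewrite -[RHS]big_enum (big_nth 1%g) -cardE.
by rewrite [#|_|](_ : _ = n`!) // card_Sn.
Qed.

(** [G] sees the sample and the seed only through the ranked sequence, which is uniform by
    [sum_rank_perm]. *)
Lemma expected_welfare_ge n m (p : R) (v : 'I_n -> setfun R m) order
    (G : 'S_n -> R) :
  (sample_size p n <= n)%N ->
  (forall i B, 0 <= v i B) ->
  (forall (S : {set 'I_n}) w, #|S| = sample_size p n ->
    G (rank_perm (seed_perm n w) S) <=
    welfare v (ALG (alg := sample_then_bid R n m) v S (order S) w)) ->
  (((n`!%:R)^-1 * \sum_x G x)%:E <=
    expected_welfare p (sample_then_bid R n m) v order)%E.
Proof.
move=> kn v0 GW; rewrite /expected_welfare.
rewrite (eq_bigr (fun S : {set 'I_n} => (n`!%:R^-1 * \sum_(w < (n`!).-1.+1)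
    welfare v (ALG (alg := sample_then_bid R n m) v S (order S) w))%:E)) => [|S _].
  rewrite sumEFin -EFinM lee_fin ler_pdivlMl ?ltr0n ?bin_gt0 //.
  rewrite mulrCA -sum_rank_perm mulr_sumr; apply: ler_sum => S /eqP Sk.
  rewrite ler_pM2l ?invr_gt0 ?ltr0n ?fact_gt0 //.
  rewrite -(sum_seed_perm (fun sigma => G (rank_perm sigma S))).
  by apply: ler_sum => w _; apply: GW.
rewrite expectation_uniform_seed => [|w]; first by rewrite prednK ?fact_gt0.
by apply: sumr_ge0.
Qed.

Lemma sample_size_bounds n : let k := sample_size (2 / 3 : R) n in
  (3 * k <= 2 * n)%N && (2 * n < 3 * k.+1)%N.
Proof.
rewrite /=; set k := sample_size _ _.
have r0 : 0 <= 2 / 3 * n%:R :> R by rewrite mulr_ge0.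
have /andP[] := truncn_itv r0; rewrite -/k => lo hi.
by apply/andP; split; [rewrite -(ler_nat R)|rewrite -(ltr_nat R)];
  rewrite !natrM; lra.
Qed.

Lemma sample_then_bid_competitive (class : forall m, setfun R m -> Prop) :
  (forall m (u : setfun R m), class m u -> is_valuation u) ->
  (forall m (u : setfun R m), class m u -> supported u) ->
  competitive 80 (2 / 3) (sample_then_bid R) class.
Proof.
move=> classv classs [//|n] m _ _ v vclass order orderP.
set k := sample_size _ _ in orderP *.
have /andP[klo khi] := sample_size_bounds n.+1; rewrite -/k in klo khi.
have kn : (k <= n)%N by lia.
have v0 i B : 0 <= v i B by case: (classv _ _ (vclass i)).
have vs i : supported (v i) by apply: classs.
have N0 : 0 < (n.+1)`!%:R :> R by rewrite ltr0n fact_gt0.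
suff [G GW GE] : exists2 G : 'S_n.+1 -> R,
    forall (S : {set 'I_n.+1}) w, #|S| = k -> G (rank_perm (seed_perm n.+1 w) S) <=
      welfare v (ALG (alg := sample_then_bid R n.+1 m) v S (order S) w) &
    forall A : {ffun 'I_n.+1 -> {set 'I_m}}, pairwise_disjoint A ->
      (n.+1)`!%:R * welfare v A <= 80 * \sum_x G x.
  apply: le_trans (expected_welfare_ge _ v0 GW); last exact: leqW.
  have GE' (A : {ffun 'I_n.+1 -> {set 'I_m}}) : pairwise_disjoint A ->
      welfare v A <= 80 * ((n.+1)`!%:R^-1 * \sum_x G x).
    by move=> /GE; rewrite mulrCA ler_pdivlMl.
  rewrite lee_fin ler_pdivrMl //; apply: bigmax_le => //.
  (* The default 0 of the maximum is bounded through the empty allocation. *)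
  apply: le_trans (GE' [ffun=> finset.set0] _); first exact: sumr_ge0.
  apply/forallP => i; apply/forallP => i'.
  by rewrite !ffunE -setI_eq0 finset.set0I eqxx implybT.
have [n3|n3] := ltnP n.+1 3.
  have kE : k = n by lia.
  exists (fun x => v (pos x k) [set: 'I_m]) => [S w Sk|A _].
    by apply: welfare_few => //; apply: orderP.
  (* The only unsampled buyer is uniform and takes everything, which loses a factor of at most
     [n.+1], here at most 2. *)
  have := sum_perm_pos (fun i => v i [set: 'I_m]) k.
  set G := \sum_x _ => GE.
  have G0 : 0 <= G by apply: sumr_ge0.
  have WT : welfare v A <= \sum_i v i [set: 'I_m].
    apply: ler_sum => i _; have [_ _] := classv _ _ (vclass i); apply.
    exact: finset.subsetT.
  rewrite -(ler_pM2l N0) -GE in WT; apply: (le_trans WT).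
  by apply: ler_wpM2r => //; rewrite ler_nat; lia.
set s := (n.+1 %/ 3)%N.
exists (fun x => \sum_j gain v s k (pos x) j) => [S w Sk|A dA].
  by apply: welfare_many => //; [apply: orderP|lia|lia].
have sk : (s + s <= k)%N by lia.
have ksn : (k + s <= n.+1)%N by lia.
have := sum_welfare_le_gain sk ksn vs dA.
set G := \sum_x _ => GE.
have W0 : 0 <= welfare v A by apply: sumr_ge0.
have s0 : 0 < s%:R :> R by rewrite ltr0n; lia.
have G0 : 0 <= 16 * G.
  rewrite -(pmulr_rge0 _ (ltr0Sn R n)); apply: le_trans GE.
  by rewrite mulr_ge0.
(* Five buyers, with [s] equal to 1, are the extreme case; 5 times 16 is the constant 80. *)
have ns : n.+1%:R <= 5 * s%:R :> R by rewrite -natrM ler_nat; lia.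
rewrite -(ler_pM2l s0) mulrA -natrM; apply: (le_trans GE).
apply: (le_trans (ler_wpM2r G0 ns)).
by rewrite le_eqVlt; apply/orP; left; apply/eqP; ring.
Qed.

End Competitive.

Theorem corollary1p2 (R : realType) :
  exists (c p : R) (alg : forall n m : nat, secretary_algorithm R n m),
    [/\ 1 <= c,
        0 < p < 1,
        competitive c p alg (@XOS R)
      & competitive c p alg (@submodular R)].
Proof.
exists 80, (2 / 3), (sample_then_bid R); split; [lra|lra| |].
  by apply: sample_then_bid_competitive => m u; [case|apply: XOS_supported].
by apply: sample_then_bid_competitive => m u; [case|apply: submodular_supported].
Qed.
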